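(* Let $k\in\mathbb{Z}^+$ with $k>1$ and $\pi\in S_k$. There exists a constant $C=C(\pi)$ such that for all integers $m,n\ge 0$ with $m\le\binom{n}{k}$, the number of permutations in $S_n$ containing at most $m$ copies of $\pi$ is at most \[\exp(Cn)\max\left(1,\left(\frac{m}{n}\right)^{\frac{n}{k-1}}\right).\] Furthermore, this bound is sharp to within an exponential factor: there is a constant $C'=C'(\pi)$ such that for all such $m,n$ the number of permutations in $S_n$ containing at most $m$ copies of $\pi$ is at least $\exp(C'n)\max\left(1,\left(\frac{m}{n}\right)^{\frac{n}{k-1}}\right)$.
   Context: A copy of $\pi\in S_k$ in $\sigma\in S_n$ is a set of indices $1\le x_1<\dots<x_k\le n$ such that for all $i,j$, $\pi(i)<\pi(j)\iff\sigma(x_i)<\sigma(x_j)$. *)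

(* Defs.v *)
From mathcomp Require Import all_boot all_fingroup.
From Stdlib Require Import Reals.
Set Implicit Arguments. Unset Strict Implicit. Unset Printing Implicit Defensive.

(* A copy of pi in 'S_k inside s in 'S_n: indices x_0 < ... < x_{k-1}
   (a strictly increasing map x : 'I_k -> 'I_n, equivalently a k-subset of
   positions) such that pi i < pi j <-> s (x i) < s (x j) for all i, j. *)
Definition is_copy (k n : nat) (pi : 'S_k) (s : 'S_n) (x : {ffun 'I_k -> 'I_n}) : bool :=
  [forall i : 'I_k, forall j : 'I_k,
     ((i < j)%N ==> (x i < x j)%N) &&
     ((pi i < pi j)%N == (s (x i) < s (x j))%N)].

Definition num_copies (k n : nat) (pi : 'S_k) (s : 'S_n) : nat :=
  #|[set x : {ffun 'I_k -> 'I_n} | is_copy pi s x]|.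

Definition count_at_most (k : nat) (pi : 'S_k) (n m : nat) : nat :=
  #|[set s : 'S_n | (num_copies pi s <= m)%N]|.

Definition bound_fn (k n m : nat) : R :=
  Rmax 1 (Rpower (INR m / INR n) (INR n / INR (k - 1))).

(* Main.v *)
(** For the upper bound, choose q with m <= n q^(k-1). A random colouring of the
    positions of a permutation with q colours leaves on average at most n
    monochromatic copies of pi, so at least half of the q^n colourings leave at most
    2n. A pair (permutation, colouring) is a set of n points in q layers of an n x n
    grid. Contracting q x q blocks leaves q layers of side about n/q, and each
    contraction comes from at most (4 q^2)^n point sets. It remains to see that there
    are only exp(O(n)) contractions. As in Klazar's reduction, contract repeatedly by
    the factor k^2; the number of choices in one step is exponential in the number of
    points of the contracted set. By the Marcus-Tardos theorem each layer has O(side)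
    points more than it has copies of pi, and recolouring with further colours makes
    the copies so rare that the numbers of points form a geometric series with sum O(n).

    For the lower bound take the permutations preserving each interval of q
    consecutive positions: as the stabiliser of a partition into t <= 2n/q parts they
    number at least n!/t^n. If pi descends from its first to its last entry, then
    every copy of pi lies in one interval, so there are at most n q^(k-1) copies;
    otherwise compose with the reversal. *)
From mathcomp Require Import zify.
Require Import Defs.
From mathcomp Require Import all_boot all_fingroup.
From Stdlib Require Import Reals Lra.
From mathcomp Require Import ssrnat.
Set Implicit Arguments. Unset Strict Implicit. Unset Printing Implicit Defensive.

(** * Increasing enumerations and counting by fibres *)

Lemma increasing_enum (n k : nat) (S : {set 'I_n}) : k <= #|S| ->
  exists e : 'I_k -> 'I_n,
    (forall i, e i \in S) /\ (forall i j : 'I_k, i < j -> e i < e j).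
Proof.
move=> kS; exists (fun i => enum_val (widen_ord kS i)); split=> [i|i j ij].
  exact: enum_valP.
have srt : sorted ltn (map val (enum S)).
  apply: (subseq_sorted ltn_trans (s2 := map val (enum 'I_n))).
    by apply: map_subseq; rewrite [enum 'I_n]enumT {1}/enum_mem; exact: filter_subseq.
  by rewrite val_enum_ord iota_ltn_sorted.
have x0 : 'I_n := enum_val (widen_ord kS i).
rewrite !(enum_val_nth x0) /=.
have szi : i < size (enum S) by rewrite -cardE (leq_trans (ltn_ord i)).
have szj : j < size (enum S) by rewrite -cardE (leq_trans (ltn_ord j)).
rewrite -!(nth_map x0 (val x0) val) //.
by apply: (sorted_ltn_nth ltn_trans) => //; rewrite inE size_map.
Qed.

Lemma card_le_fibers (T U : finType) (f : T -> U) (A : {set T}) (B : {set U}) (w : nat) :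
  (forall p, p \in A -> f p \in B) ->
  (forall u, u \in B -> #|[set p in A | f p == u]| <= w) ->
  #|A| <= #|B| * w.
Proof.
move=> fAB fw.
rewrite -sum1_card (partition_big f (mem B)) //= -sum_nat_const.
apply: leq_sum => u uB; apply: leq_trans (fw u uB).
by rewrite -sum1_card; apply: eq_leq; apply: eq_bigl => p; rewrite inE.
Qed.

Lemma pigeonhole_fiber (T U : finType) (f : T -> U) (A : {set T}) (B : {set U}) (w : nat) :
  (forall p, p \in A -> f p \in B) -> #|B| * w < #|A| ->
  exists2 u, u \in B & w < #|[set p in A | f p == u]|.
Proof.
move=> fAB; have [/existsP[u /andP[uB uw]] _|] :=
  boolP [exists u, (u \in B) && (w < #|[set p in A | f p == u]|)]; first by exists u.
rewrite negb_exists => /forallP H; rewrite ltnNge => /negP[].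
apply: (card_le_fibers fAB) => u uB.
by move: (H u); rewrite uB /= -leqNgt.
Qed.

(** * The Marcus-Tardos theorem *)

Section Contraction.
Variable n : nat.

(** The quotient stays in ['I_n], so that contraction can be iterated within one type; [box] records
    the side really occupied. *)
Definition odiv (b : nat) (x : 'I_n) : 'I_n :=
  Ordinal (leq_ltn_trans (leq_div x b) (ltn_ord x)).

Definition contract (b : nat) (p : 'I_n * 'I_n) : 'I_n * 'I_n :=
  (odiv b p.1, odiv b p.2).

Definition box (N : nat) : {set 'I_n * 'I_n} := [set p : 'I_n * 'I_n | (p.1 < N) && (p.2 < N)].

Definition strip (b : nat) (a : 'I_n) : {set 'I_n} := [set x | odiv b x == a].

Lemma card_strip (b : nat) (a : 'I_n) : 0 < b -> #|strip b a| <= b.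
Proof.
case: b => // b _; rewrite -[X in _ <= X]card_ord.
have /card_in_imset <- : {in strip b.+1 a &, injective (fun x : 'I_n => inord (x %% b.+1) : 'I_b.+1)}.
  move=> x y; rewrite !inE => /eqP/(congr1 val)/= xa /eqP/(congr1 val)/= ya.
  move=> /(congr1 val)/=; rewrite !inordK ?ltn_mod // => e.
  by apply: val_inj; rewrite /= (divn_eq x b.+1) (divn_eq y b.+1) xa ya e.
exact: max_card.
Qed.

Lemma card_ord_lt (N : nat) : #|[set x : 'I_n | x < N]| <= N.
Proof.
case: N => [|N]; first by rewrite (_ : [set _ | _] = set0) ?cards0 //; apply/setP => x; rewrite !inE.
rewrite -[X in _ <= X]card_ord.
have /card_in_imset <- : {in [set x : 'I_n | x < N.+1] &, injective (fun x : 'I_n => inord x : 'I_N.+1)}.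
  by move=> x y; rewrite !inE => xN yN /(congr1 val); rewrite /= !inordK // => /val_inj.
exact: max_card.
Qed.

Lemma card_block (b : nat) (u : 'I_n * 'I_n) : 0 < b ->
  #|[set p : 'I_n * 'I_n | contract b p == u]| <= b * b.
Proof.
move=> b0; apply: (@leq_trans #|setX (strip b u.1) (strip b u.2)|).
  by apply: subset_leq_card; apply/subsetP => p; rewrite !inE -pair_eqE.
by rewrite cardsX leq_mul // card_strip.
Qed.

Lemma odiv_lt (b : nat) (x y : 'I_n) : odiv b x < odiv b y -> x < y.
Proof. by rewrite /= !ltnNge; apply: contra; apply: leq_div2r. Qed.

Lemma contract_box (b N : nat) (p : 'I_n * 'I_n) : 0 < b ->
  p \in box (b * N) -> contract b p \in box N.
Proof. by move=> b0; rewrite !inE /= !ltn_divLR // ![_ * b]mulnC. Qed.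

End Contraction.

Section MarcusTardos.
Variables k n : nat.
Implicit Types (pi : 'S_k) (A : {set 'I_n * 'I_n}).

(** One-way implications suffice: distinct [i] and [j] have distinct values under [pi], so the
    converses follow. *)
Definition embeds pi (f : 'I_k -> 'I_n * 'I_n) : bool :=
  [forall i : 'I_k, forall j : 'I_k,
    ((i < j) ==> ((f i).1 < (f j).1)) && ((pi i < pi j) ==> ((f i).2 < (f j).2))].

Lemma embedsP pi (f : 'I_k -> 'I_n * 'I_n) :
  reflect ((forall i j : 'I_k, i < j -> (f i).1 < (f j).1) /\
           (forall i j : 'I_k, pi i < pi j -> (f i).2 < (f j).2)) (embeds pi f).
Proof.
apply: (iffP idP) => [/forallP H|[H1 H2]].
  by split=> i j ij; move/forallP/(_ j)/andP: (H i) => [/implyP h1 /implyP h2]; auto.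
by apply/forallP => i; apply/forallP => j; apply/andP; split; apply/implyP; auto.
Qed.

Definition contains pi A : Prop :=
  exists2 f : 'I_k -> 'I_n * 'I_n, embeds pi f & forall i, f i \in A.

Definition transpose A : {set 'I_n * 'I_n} := [set p : 'I_n * 'I_n | (p.2, p.1) \in A].

Lemma contains_transpose pi A : contains pi^-1 (transpose A) -> contains pi A.
Proof.
case=> f /embedsP[f1 f2] fA; exists (fun i => ((f (pi i)).2, (f (pi i)).1)).
  apply/embedsP; split=> i j ij /=; last exact: f1.
  by apply: f2; rewrite !permK.
by move=> i; move: (fA (pi i)); rewrite inE.
Qed.

(** One point is chosen from each block; strictly ordered block indices force strictly ordered
    coordinates. *)
Lemma contains_contract b pi A : contains pi (contract b @: A) -> contains pi A.
Proof.
case=> f /embedsP[f1 f2] fA.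
have H i : {p | (p \in A) && (contract b p == f i)}.
  by apply: sigW; case/imsetP: (fA i) => p pA ->; exists p; rewrite pA eqxx.
exists (fun i => sval (H i)) => [|i]; last by case: (H i) => p /= /andP[].
apply/embedsP; split=> i j ij; case: (H i) (H j) => p /andP[_ /eqP ep] [r /andP[_ /eqP er]] /=;
  apply: (@odiv_lt _ b).
- by have := f1 _ _ ij; rewrite -ep -er.
- by have := f2 _ _ ij; rewrite -ep -er.
Qed.

Definition block b A (u : 'I_n * 'I_n) := [set p in A | contract b p == u].

Definition wide b A (u : 'I_n * 'I_n) : bool := k <= #|fst @: block b A u|.

(* By pigeonhole, k wide blocks of the same strip occupy the same columns; taking
   the i-th of those columns in the (pi i)-th of those blocks embeds pi. *)
Lemma wide_in_strip b pi A (a : 'I_n) : 0 < k -> 0 < b -> ~ contains pi A ->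
  #|[set v | wide b A (a, v)]| <= 2 ^ b * k.
Proof.
move=> k0 b0 avA; rewrite leqNgt; apply/negP => big; apply: avA.
pose W := [set v | wide b A (a, v)]; pose cols v := fst @: block b A (a, v).
have colsS v : v \in W -> cols v \in powerset (strip b a).
  move=> _; rewrite inE; apply/subsetP => x /imsetP[p].
  by rewrite !inE -pair_eqE => /andP[_ /andP[/= /eqP <- _]] ->.
have big' : #|powerset (strip b a)| * k < #|W|.
  by apply: (leq_ltn_trans _ big); rewrite leq_mul2r card_powerset leq_exp2l ?card_strip ?orbT.
have [R RB kR] := pigeonhole_fiber colsS big'.
have [ev [evS ev_lt]] := increasing_enum (ltnW kR).
have kcols : k <= #|R|.
  have := evS (Ordinal k0); rewrite !inE => /andP[].
  by rewrite /wide => + /eqP <-.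
have [ex [exS ex_lt]] := increasing_enum kcols.
have H i : {p | [&& p \in A, p.1 == ex i & odiv b p.2 == ev (pi i)]}.
  apply: sigW; have := evS (pi i); rewrite !inE => /andP[_ /eqP eR].
  have := exS i; rewrite -eR => /imsetP[p]; rewrite !inE -pair_eqE.
  by move=> /andP[pA /andP[_ p2]] ->; exists p; rewrite pA eqxx.
exists (fun i => sval (H i)) => [|i]; last by case: (H i) => p /= /and3P[].
apply/embedsP; split=> i j ij;
  case: (H i) (H j) => p /and3P[_ /eqP p1 /eqP p2] [r /and3P[_ /eqP r1 /eqP r2]] /=.
- by rewrite p1 r1 ex_lt.
- by apply: (@odiv_lt _ b); rewrite p2 r2 ev_lt.
Qed.

Lemma card_wide b N pi A : 0 < k -> 0 < b -> ~ contains pi A ->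
  A \subset box n (b * N) ->
  #|[set u : 'I_n * 'I_n | wide b A u]| <= N * (2 ^ b * k).
Proof.
move=> k0 b0 avA AN.
apply: leq_trans (_ : #|[set a : 'I_n | a < N]| * (2 ^ b * k) <= _).
  apply: (card_le_fibers (f := fst)) => [[a v]|a _].
    rewrite !inE /wide /= => kw.
    have : 0 < #|fst @: block b A (a, v)| by apply: leq_trans kw.
    rewrite card_gt0 => /set0Pn[x /imsetP[p]]; rewrite inE => /andP[pA /eqP pav] _.
    have := contract_box b0 (subsetP AN _ pA).
    by rewrite pav inE /= => /andP[].
  apply: leq_trans (wide_in_strip a k0 b0 avA).
  rewrite -(card_imset _ (_ : injective (fun v : 'I_n => (a, v)))); last by move=> ? ? [].
  apply: subset_leq_card; apply/subsetP => -[a' v]; rewrite !inE /= => /andP[w /eqP e].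
  by apply/imsetP; exists v; rewrite ?inE -e.
by rewrite leq_mul2r card_ord_lt orbT.
Qed.

Lemma card_le_proj (B : {set 'I_n * 'I_n}) : #|B| <= #|fst @: B| * #|snd @: B|.
Proof.
rewrite -cardsX; apply: subset_leq_card; apply/subsetP => p pB.
by rewrite !inE; apply/andP; split; apply/imsetP; exists p.
Qed.

Lemma card_transpose A : #|transpose A| = #|A|.
Proof.
pose sw (p : 'I_n * 'I_n) := (p.2, p.1).
have swK : involutive sw by case.
rewrite -(card_imset (mem A) (inv_inj swK)); congr #|pred_of_set _|.
apply/setP => p; rewrite inE; apply/idP/imsetP => [pA|[q qA ->]]; last by rewrite -surjective_pairing.
by exists (sw p); rewrite ?swK.
Qed.

Lemma transpose_box N A : A \subset box n N -> transpose A \subset box n N.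
Proof.
by move=> /subsetP AN; apply/subsetP => p; rewrite inE => /AN; rewrite !inE andbC.
Qed.

Definition tall b A (u : 'I_n * 'I_n) : bool := k <= #|snd @: block b A u|.

Lemma tall_transpose b A u : tall b A u = wide b (transpose A) (u.2, u.1).
Proof.
rewrite /tall /wide; congr (_ <= #|pred_of_set _|); apply/setP => y.
apply/imsetP/imsetP => -[[p1 p2]]; rewrite !inE /= -!pair_eqE /= => /andP[pA /andP[e1 e2]] ->.
  by exists (p2, p1); rewrite // !inE -pair_eqE /= pA e1 e2.
by exists (p2, p1); rewrite // !inE -pair_eqE /= pA e1 e2.
Qed.

Lemma card_tall b N pi A : 0 < k -> 0 < b -> ~ contains pi A ->
  A \subset box n (b * N) ->
  #|[set u : 'I_n * 'I_n | tall b A u]| <= N * (2 ^ b * k).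
Proof.
move=> k0 b0 avA AN.
have avT : ~ contains pi^-1 (transpose A) by move/contains_transpose.
apply: leq_trans (card_wide k0 b0 avT (transpose_box AN)).
rewrite -(card_transpose [set u : 'I_n * 'I_n | wide _ _ _]); apply: subset_leq_card.
by apply/subsetP => u; rewrite !inE tall_transpose.
Qed.

(** A full block has [k ^ 2 * k ^ 2] points, a strip of a set avoiding [pi] has at most
    [2 ^ (k ^ 2) * k] wide blocks, and the 2 stands for wide and tall. *)
Definition mt_const := 2 * ((k ^ 2 * k ^ 2) * (2 ^ (k ^ 2) * k)).

(** A block neither wide nor tall meets fewer than [k] columns and fewer than [k] rows, which leaves
    room for [(k - 1) ^ 2] points; wide and tall blocks are charged in full. *)
Lemma marcus_tardos_step N pi A : 0 < k -> ~ contains pi A ->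
  A \subset box n (k ^ 2 * N) ->
  #|A| <= #|contract (k ^ 2) @: A| * (k.-1 * k.-1) + N * mt_const.
Proof.
move=> k0 avA AN; set b := k ^ 2; have b0 : 0 < b by rewrite expn_gt0 k0.
pose w := [set u : 'I_n * 'I_n | wide b A u]; pose t := [set u : 'I_n * 'I_n | tall b A u].
have cw := card_wide k0 b0 avA AN; have ct := card_tall k0 b0 avA AN.
have blockle u : #|block b A u| <= b * b.
  apply: leq_trans (card_block u b0); apply: subset_leq_card.
  by apply/subsetP => p; rewrite !inE => /andP[].
have -> : #|A| = \sum_(u in contract b @: A) #|block b A u|.
  rewrite -sum1_card (partition_big (contract b) [in contract b @: A]) /=; last first.
    by move=> p pA; apply: imset_f.
  by apply: eq_bigr => u _; rewrite -sum1_card; apply: eq_bigl => p; rewrite inE.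
apply: (@leq_trans (\sum_(u in contract b @: A)
    ((k.-1 * k.-1) + ((u \in w) * (b * b) + (u \in t) * (b * b))))).
  apply: leq_sum => u _; have := blockle u; have := card_le_proj (block b A u).
  rewrite !inE; case: (boolP (wide _ _ _)) => [_ _ h|].
    by apply: leq_trans h _; rewrite mul1n addnCA leq_addr.
  case: (boolP (tall _ _ _)) => [_ _ _ h|].
    by apply: leq_trans h _; rewrite mul1n addnA leq_addl.
  rewrite -!ltnNge => h1 h2 h3 _; apply: leq_trans h3 _.
  by rewrite !mul0n !addn0 leq_mul // -ltnS prednK.
rewrite big_split /= sum_nat_const leq_add2l big_split /=.
have bnd (S : {set 'I_n * 'I_n}) : #|S| <= N * (2 ^ b * k) ->
    \sum_(u in contract b @: A) (u \in S) * (b * b) <= N * ((b * b) * (2 ^ b * k)).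
  move=> cS; rewrite -big_distrl /=.
  have : \sum_(u in contract b @: A) (u \in S) <= #|S|.
    rewrite -sum1_card [X in _ <= X]big_mkcond /= big_mkcond /=; apply: leq_sum => u _.
    by case: ifP; case: (u \in S).
  by move=> h; rewrite [X in _ <= X]mulnCA [X in X <= _]mulnC leq_mul2l (leq_trans h) ?orbT.
have := leq_add (bnd _ cw) (bnd _ ct).
by rewrite /mt_const -/b addnn -mul2n mulnCA.
Qed.

End MarcusTardos.

Theorem marcus_tardos (k n J : nat) (pi : 'S_k) (A : {set 'I_n * 'I_n}) : 0 < k ->
  ~ contains pi A -> A \subset box n ((k ^ 2) ^ J) ->
  #|A| <= mt_const k * (k ^ 2) ^ J.
Proof.
move=> k0; have c0 : 0 < mt_const k by rewrite !muln_gt0 !expn_gt0 k0.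
elim: J A => [|J IH] A avA AN.
  rewrite muln1; apply: leq_trans c0; apply/card_le1_eqP => -[x1 x2] [y1 y2].
  move=> /(subsetP AN) + /(subsetP AN); rewrite !inE /= expn0 !ltnS !leqn0.
  move=> /andP[/eqP e1 /eqP e2] /andP[/eqP e3 /eqP e4].
  by congr pair; apply: val_inj => /=; rewrite ?e1 ?e2 ?e3 ?e4.
rewrite expnS in AN *; have b0 : 0 < k ^ 2 by rewrite expn_gt0 k0.
apply: leq_trans (marcus_tardos_step k0 avA AN) _.
have avA' : ~ contains pi (contract (k ^ 2) @: A) by move/contains_contract.
have A'N : contract (k ^ 2) @: A \subset box n ((k ^ 2) ^ J).
  by apply/subsetP => u /imsetP[p pA ->]; apply: contract_box (subsetP AN _ pA).
have h := IH _ avA' A'N.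
move: {IH} h; set c := mt_const k; set M := _ ^ J => h.
(* This inequality lets the induction close with the constant unchanged. *)
have kk : k.-1 * k.-1 + 1 <= k ^ 2 by rewrite -(prednK k0) /=; lia.
rewrite [X in _ <= X]mulnCA [X in _ <= X]mulnC; apply: leq_trans (leq_mul (leqnn (c * M)) kk).
by rewrite mulnDr muln1 [M * c]mulnC leq_add2r leq_mul2r h orbT.
Qed.

(** * Layered point sets with few copies *)

Section Layers.
Variables (k n : nat) (pi : 'S_k).
Implicit Type C : finType.

Definition occ C (A : {set C * ('I_n * 'I_n)}) : {set C * {ffun 'I_k -> 'I_n * 'I_n}} :=
  [set cf : C * {ffun 'I_k -> 'I_n * 'I_n} |
    embeds pi cf.2 && [forall i, (cf.1, cf.2 i) \in A]].

Lemma occP C (A : {set C * ('I_n * 'I_n)}) c (f : {ffun 'I_k -> 'I_n * 'I_n}) :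
  reflect (embeds pi f /\ forall i, (c, f i) \in A) ((c, f) \in occ A).
Proof.
by rewrite inE /=; apply: (iffP andP) => -[h1] => [/forallP|] h2; split=> //; apply/forallP.
Qed.

Lemma occS C (A B : {set C * ('I_n * 'I_n)}) : A \subset B -> occ A \subset occ B.
Proof.
move=> /subsetP AB; apply/subsetP => -[c f] /occP[ef fA].
by apply/occP; split=> // i; apply: AB.
Qed.

Definition lbox C (N : nat) : {set C * ('I_n * 'I_n)} :=
  [set p : C * ('I_n * 'I_n) | p.2 \in box n N].

(** Deleting a point of a copy costs one point and destroys at least one copy; once no copy is left,
    Marcus-Tardos applies to each layer. *)
Lemma card_le_occ C (J : nat) (A : {set C * ('I_n * 'I_n)}) : 0 < k ->
  A \subset lbox C ((k ^ 2) ^ J) ->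
  #|A| <= #|C| * (mt_const k * (k ^ 2) ^ J) + #|occ A|.
Proof.
move=> k0; set N := _ ^ J; have [a] := ubnP #|A|; elim: a A => // a IH A.
rewrite ltnS => Aa AN; have [|big] := leqP #|A| (#|C| * (mt_const k * N)).
  by move=> h; apply: leq_trans h (leq_addr _ _).
have [o0|[[c f] fo]] := set_0Vmem (occ A).
  have fstT p : p \in A -> p.1 \in [set: C] by rewrite inE.
  have [|c _] := pigeonhole_fiber (f := fst) (w := mt_const k * N) fstT.
    by rewrite cardsT.
  rewrite ltnNge => /negP[].
  have injc : injective (fun p : 'I_n * 'I_n => (c, p)) by move=> ? ? [].
  pose L := [set p : 'I_n * 'I_n | (c, p) \in A].
  apply: (@leq_trans #|L|).
    rewrite -(card_imset _ injc); apply: subset_leq_card; apply/subsetP => -[c' p].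
    by rewrite inE /= => /andP[pA /eqP e]; rewrite e in pA *; apply: imset_f; rewrite inE.
  apply: marcus_tardos k0 _ _ => [[f ef fL]|].
    suff : (c, [ffun i => f i]) \in occ A by rewrite o0 inE.
    apply/occP; split=> [|i]; last by move: (fL i); rewrite ffunE inE.
    by move/embedsP: ef => [e1 e2]; apply/embedsP; split=> i j; rewrite !ffunE; [exact: e1|exact: e2].
  by apply/subsetP => p; rewrite inE => /(subsetP AN); rewrite inE.
have [_ fA] := occP _ _ _ fo; pose p := (c, f (Ordinal k0)).
have cA := cardsD1 p A; have co := cardsD1 (c, f) (occ A).
rewrite fA add1n in cA; rewrite fo add1n in co.
have DA : A :\ p \subset A by apply: subD1set.
have oD : occ (A :\ p) \subset occ A :\ (c, f).
  apply/subsetP => g go; rewrite inE (subsetP (occS DA)) // andbT inE.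
  by apply: contraTneq go => ->; apply/negP => /occP[_ /(_ (Ordinal k0))]; rewrite !inE eqxx.
have h1 : #|A :\ p| < a by rewrite cA in Aa.
have h2 := IH _ h1 (subset_trans DA AN); have h3 := subset_leq_card oD.
by rewrite cA co addnS ltnS (leq_trans h2) // leq_add2l.
Qed.

(** * Refining the layers by a random colouring of the positions *)

Definition recolor C (D : finType) (chi : {ffun 'I_n -> D}) (A : {set C * ('I_n * 'I_n)}) :
    {set (C * D) * ('I_n * 'I_n)} :=
  [set ((p.1, chi p.2.1), p.2) | p in A].

Lemma in_recolor C (D : finType) (chi : {ffun 'I_n -> D}) A (p : C * D * ('I_n * 'I_n)) :
  (p \in recolor chi A) = ((p.1.1, p.2) \in A) && (chi p.2.1 == p.1.2).
Proof.
apply/imsetP/andP => [[[c u] cuA ->]|[pA /eqP e]]; first by rewrite /= eqxx.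
by exists (p.1.1, p.2) => //=; rewrite e -!surjective_pairing.
Qed.

Lemma card_recolor C (D : finType) (chi : {ffun 'I_n -> D}) (A : {set C * ('I_n * 'I_n)}) :
  #|recolor chi A| = #|A|.
Proof. by rewrite card_imset // => -[c u] [c' u'] [-> _ ->]. Qed.

Lemma recolor_box C (D : finType) (chi : {ffun 'I_n -> D}) (A : {set C * ('I_n * 'I_n)}) N :
  A \subset lbox C N -> recolor chi A \subset lbox _ N.
Proof.
by move=> /subsetP AN; apply/subsetP => p; rewrite in_recolor => /andP[/AN + _]; rewrite !inE.
Qed.

Definition mono (D : finType) (chi : {ffun 'I_n -> D}) (g : 'I_k -> 'I_n) : bool :=
  [exists d, forall i, chi (g i) == d].

(** A copy in a refined layer is a monochromatic copy in the old layer, and its first point already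
    fixes the new colour. *)
Lemma card_occ_recolor C (D : finType) (chi : {ffun 'I_n -> D}) (A : {set C * ('I_n * 'I_n)}) :
  0 < k -> #|occ (recolor chi A)| <= #|[set cf in occ A | mono chi (fun i => (cf.2 i).1)]|.
Proof.
move=> k0; pose h (x : (C * D) * {ffun 'I_k -> 'I_n * 'I_n}) := (x.1.1, x.2).
have /card_in_imset <- : {in occ (recolor chi A) &, injective h}.
  move=> [[c d] f] [[c' d'] f'] /occP[_ fA] /occP[_ fA'] [-> ff']; rewrite ff' in fA *.
  by have := fA (Ordinal k0); have := fA' (Ordinal k0); rewrite !in_recolor /=
    => /andP[_ /eqP ->] /andP[_ /eqP ->].
apply: subset_leq_card; apply/subsetP => _ /imsetP[[[c d] f] /occP[ef fA] ->].
rewrite inE; apply/andP; split.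
  by apply/occP; split=> // i; have := fA i; rewrite in_recolor => /andP[].
by apply/existsP; exists d; apply/forallP => i; have := fA i; rewrite in_recolor => /andP[].
Qed.

(* A monochromatic colouring chi and k colours psi are recovered from the colour of
   g under chi and the colouring obtained by overwriting chi with psi along g. *)
Lemma card_mono (D : finType) (g : 'I_k -> 'I_n) : 0 < k -> injective g ->
  #|[set chi : {ffun 'I_n -> D} | mono chi g]| * #|D| ^ k <= #|D| * #|D| ^ n.
Proof.
move=> k0 gi; pose i0 := Ordinal k0.
pose ow (x : {ffun 'I_n -> D} * {ffun 'I_k -> D}) : D * {ffun 'I_n -> D} :=
  (x.1 (g i0), [ffun y => if [pick i | g i == y] is Some i then x.2 i else x.1 y]).
have -> : #|D| ^ k = #|[set: {ffun 'I_k -> D}]| by rewrite cardsT card_ffun card_ord.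
have -> : #|D| * #|D| ^ n = #|[set: D * {ffun 'I_n -> D}]|.
  by rewrite cardsT card_prod card_ffun card_ord.
rewrite -cardsX.
have /card_in_imset <- : {in setX [set chi | mono chi g] [set: {ffun 'I_k -> D}] &, injective ow}.
  move=> [chi psi] [chi' psi']; rewrite !inE !andbT /= => /existsP[d /forallP hd].
  move=> /existsP[d' /forallP hd'] [e /ffunP E].
  have pg i : [pick j | g j == g i] = Some i.
    by case: pickP => [j /eqP/gi -> //|/(_ i)]; rewrite eqxx.
  congr pair; apply/ffunP => y; last by have := E (g y); rewrite !ffunE pg.
  have := E y; rewrite !ffunE; case: pickP => [j /eqP <- _|//].
  by move: e; rewrite (eqP (hd i0)) (eqP (hd' i0)) (eqP (hd j)) (eqP (hd' j)).
by apply: subset_leq_card; apply/subsetP => x; rewrite inE.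
Qed.

Lemma embeds_inj (f : 'I_k -> 'I_n * 'I_n) : embeds pi f -> injective (fun i => (f i).1).
Proof.
move=> /embedsP[f1 _] i j /= e.
by case: (ltngtP i j) => [/f1|/f1|/val_inj//]; rewrite e ltnn.
Qed.

(** An expectation with denominators cleared: the [k] points of a copy have distinct positions, so
    it is monochromatic with probability at most [#|D| ^ (1 - k)]. *)
Lemma sum_occ_recolor C (D : finType) (A : {set C * ('I_n * 'I_n)}) : 0 < k ->
  (\sum_(chi : {ffun 'I_n -> D}) #|occ (recolor chi A)|) * #|D| ^ k <=
  #|occ A| * (#|D| * #|D| ^ n).
Proof.
move=> k0; pose mon (chi : {ffun 'I_n -> D}) (cf : C * {ffun 'I_k -> 'I_n * 'I_n}) :=
  mono chi (fun i => (cf.2 i).1).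
apply: (@leq_trans ((\sum_(chi : {ffun 'I_n -> D}) \sum_(cf in occ A) mon chi cf) * #|D| ^ k)).
  rewrite leq_mul2r; apply/orP; right. apply: leq_sum => chi _.
  apply: leq_trans (card_occ_recolor chi A k0) _; apply: eq_leq.
  rewrite -sum1_card (eq_bigl (fun cf => (cf \in occ A) && mon chi cf)); last by move=> cf; rewrite inE.
  by rewrite big_mkcondr; apply: eq_bigr => cf _; case: (mon chi cf).
rewrite exchange_big big_distrl /= -[X in _ <= X]sum_nat_const; apply: leq_sum => -[c f] /occP[ef _].
apply: leq_trans (card_mono D k0 (embeds_inj ef)); apply: eq_leq; congr (_ * _).
rewrite -sum1_card [RHS]big_mkcond /=; apply: eq_bigr => chi _.
by rewrite inE /mon /=; case: (mono _ _).
Qed.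

(** Averaging [card_le_occ] over all colourings with [r] colours: the layers multiply by [r], while
    the mean number of copies falls by a factor of at least [r ^ (k - 1) >= r]. *)
Lemma supersaturation C (J r : nat) (A : {set C * ('I_n * 'I_n)}) : 1 < k -> 0 < r ->
  A \subset lbox C ((k ^ 2) ^ J) ->
  r * #|A| <= r * (#|C| * r * (mt_const k * (k ^ 2) ^ J)) + #|occ A|.
Proof.
move=> k1 r0 AN; have k0 := ltnW k1; set B := #|C| * r * _.
have le1 (chi : {ffun 'I_n -> 'I_r}) : #|A| <= B + #|occ (recolor chi A)|.
  have := card_le_occ k0 (recolor_box chi AN).
  by rewrite card_recolor card_prod card_ord.
have : \sum_(chi : {ffun 'I_n -> 'I_r}) #|A| <=
       \sum_(chi : {ffun 'I_n -> 'I_r}) (B + #|occ (recolor chi A)|).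
  by apply: leq_sum => chi _; apply: le1.
rewrite big_split /= !sum_nat_const card_ffun !card_ord => h1.
have := sum_occ_recolor 'I_r A k0; rewrite card_ord => h2.
have rn : 0 < r ^ n by rewrite expn_gt0 r0.
have rk : 0 < r ^ (k - 2) by rewrite expn_gt0 r0.
(* Here [1 < k] enters; the surplus factor [r ^ (k - 2)] is given away in [h4]. *)
have ek : r ^ k = r * r * r ^ (k - 2) by rewrite -{1}(subnKC k1) expnD expnS expn1.
rewrite -(leq_pmul2l rk) -(leq_pmul2l rn) -(leq_pmul2l r0).
have := leq_mul h1 (leqnn (r ^ k)); rewrite mulnDl => h3.
have h4 : #|occ A| * (r * r ^ n) <= r * (r ^ n * (r ^ (k - 2) * #|occ A|)).
  by rewrite [X in _ <= X]mulnA [X in _ <= X]mulnC leq_mul2r leq_pmull ?orbT.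
have := leq_trans h3 (leq_add (leqnn _) (leq_trans h2 h4)).
have eA z : r ^ n * z * r ^ k = r * (r ^ n * (r ^ (k - 2) * (r * z))).
  rewrite ek -!mulnA [RHS]mulnCA; congr (_ * _); rewrite mulnCA; congr (_ * _).
  by rewrite mulnC -mulnA mulnCA.
by rewrite !eA !mulnDr.
Qed.

(** * Contraction of layered sets and Klazar's reduction *)

Definition lcontract C (b : nat) (p : C * ('I_n * 'I_n)) := (p.1, contract b p.2).

(** Choosing a preimage of each point of a copy in the contraction gives a copy in [A] that
    contracts back to it. *)
Lemma card_occ_contract C (b : nat) (A : {set C * ('I_n * 'I_n)}) :
  #|occ (lcontract b @: A)| <= #|occ A|.
Proof.
pose h (x : C * {ffun 'I_k -> 'I_n * 'I_n}) := (x.1, [ffun i => contract b (x.2 i)]).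
apply: leq_trans (leq_imset_card h (occ A)); apply: subset_leq_card.
apply/subsetP => -[c f] /occP[/embedsP[f1 f2] fA].
have H i : {u | ((c, u) \in A) && (contract b u == f i)}.
  by apply: sigW; case/imsetP: (fA i) => -[c' u] uA [-> ->]; exists u; rewrite uA eqxx.
apply/imsetP; exists (c, [ffun i => sval (H i)]).
  apply/occP; split=> [|i]; last by rewrite ffunE; case: (H i) => u /= /andP[].
  apply/embedsP; split=> i j ij; rewrite !ffunE;
    case: (H i) (H j) => u /andP[_ /eqP eu] [v /andP[_ /eqP ev]] /=; apply: (@odiv_lt _ b).
  - by have := f1 _ _ ij; rewrite -eu -ev.
  - by have := f2 _ _ ij; rewrite -eu -ev.
congr pair; apply/ffunP => i; rewrite !ffunE /=.
by case: (H i) => u /= /andP[_ /eqP ->].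
Qed.

Lemma card_lcontract_preim C (b : nat) (A : {set C * ('I_n * 'I_n)}) : 0 < b ->
  #|[set p | lcontract b p \in A]| <= #|A| * (b * b).
Proof.
move=> b0; apply: (card_le_fibers (f := lcontract b)) => [p|[c u] _]; first by rewrite inE.
apply: leq_trans (card_block u b0).
have injc : injective (fun p : 'I_n * 'I_n => (c, p)) by move=> ? ? [].
rewrite -(card_imset _ injc); apply: subset_leq_card; apply/subsetP => -[c' p].
by rewrite !inE => /andP[_ /eqP[-> e]]; apply/imsetP; exists p; rewrite // inE e.
Qed.

Lemma lcontract_box C (b N : nat) (A : {set C * ('I_n * 'I_n)}) : 0 < b ->
  A \subset lbox C (b * N) -> lcontract b @: A \subset lbox C N.
Proof.
move=> b0 /subsetP AN; apply/subsetP => _ /imsetP[p pA ->].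
by rewrite inE; apply: contract_box => //; have := AN _ pA; rewrite inE.
Qed.

Definition sparse_sets C (N m : nat) : {set {set C * ('I_n * 'I_n)}} :=
  [set A : {set C * ('I_n * 'I_n)} | (A \subset lbox C N) && (#|occ A| <= m)].

Lemma lcontract_sparse C (b N m : nat) A : 0 < b ->
  A \in sparse_sets C (b * N) m -> lcontract b @: A \in sparse_sets C N m.
Proof.
move=> b0; rewrite !inE => /andP[AN Am].
by rewrite lcontract_box //= (leq_trans (card_occ_contract b A)).
Qed.

(** A set with contraction [A'] is a subset of the union of the blocks over [A'], which has at most
    [w * (b * b)] points. *)
Lemma klazar_step C (b N m w : nat) : 0 < b ->
  (forall A, A \in sparse_sets C N m -> #|A| <= w) ->
  #|sparse_sets C (b * N) m| <= #|sparse_sets C N m| * 2 ^ (w * (b * b)).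
Proof.
move=> b0 fw.
apply: (card_le_fibers (f := fun A : {set C * ('I_n * 'I_n)} => lcontract b @: A)) => [A|A' A'F].
  exact: lcontract_sparse.
apply: (@leq_trans #|powerset [set p | lcontract b p \in A']|).
  apply: subset_leq_card; apply/subsetP => A; rewrite inE => /andP[_ /eqP <-].
  by rewrite inE; apply/subsetP => p pA; rewrite inE imset_f.
rewrite card_powerset leq_exp2l //; apply: leq_trans (card_lcontract_preim A' b0) _.
by rewrite leq_mul2r fw ?orbT.
Qed.

Lemma klazar C (J m : nat) : 1 < k ->
  #|sparse_sets C ((k ^ 2) ^ J) m| <=
  2 ^ (#|C| + (#|C| * (mt_const k * (k ^ 2) ^ J) + m) * (k ^ 2 * k ^ 2)).
Proof.
move=> k1; have k0 := ltnW k1; set E := _ + m; set b := k ^ 2.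
have b0 : 0 < b by rewrite expn_gt0 k0.
have kJ : 0 < k ^ J by rewrite expn_gt0 k0.
(* Bound on the number of points at side b ^ i, obtained by recolouring with k ^ (J - i)
   colours; these bounds sum to at most E. *)
pose w i := (k ^ i * E) %/ k ^ J.
have step i : i <= J ->
    #|sparse_sets C (b ^ i) m| <= 2 ^ (#|C| + (\sum_(j < i) w j) * (b * b)).
  elim: i => [_|i IH iJ].
    rewrite big_ord0 mul0n addn0 expn0.
    apply: (@leq_trans #|powerset (lbox C 1)|).
      by apply: subset_leq_card; apply/subsetP => A; rewrite !inE => /andP[].
    (* At side 1 each layer has at most one point. *)
    rewrite card_powerset leq_exp2l // -(@card_in_imset _ _ fst).
      exact: max_card.
    move=> [c1 [x1 y1]] [c2 [x2 y2]]; rewrite !inE /= !ltnS !leqn0.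
    move=> /andP[/eqP e1 /eqP e2] /andP[/eqP e3 /eqP e4] ->.
    by congr (_, (_, _)); apply: val_inj => /=; rewrite ?e1 ?e2 ?e3 ?e4.
  rewrite expnS big_ord_recr /= mulnDl addnA expnD.
  apply: leq_trans (_ : #|sparse_sets C (b ^ i) m| * 2 ^ (w i * (b * b)) <= _); last first.
    by rewrite leq_mul2r IH ?orbT // ltnW.
  apply: klazar_step b0 _ => A; rewrite inE => /andP[AN Am].
  have r0 : 0 < k ^ (J - i) by rewrite expn_gt0 k0.
  have := supersaturation k1 r0 AN; rewrite leq_divRL // => h.
  have eJ : k ^ J = k ^ i * k ^ (J - i) by rewrite -expnD subnKC // ltnW.
  rewrite eJ mulnC -mulnA leq_mul2l; apply/orP; right.
  apply: leq_trans h _; rewrite /E; apply: leq_add => //.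
  (* With [r = k ^ (J - i)] colours, [r] times the Marcus-Tardos term is the same at every level
     [i]. *)
  have -> : (k ^ 2) ^ J = k ^ (J - i) * k ^ (J - i) * (k ^ 2) ^ i.
    by rewrite -!expnM -!expnD; congr (k ^ _); clear -iJ; lia.
  move: (k ^ (J - i)) ((k ^ 2) ^ i) (mt_const k) #|C| => x y c d; apply: eq_leq. lia.
apply: leq_trans (step J (leqnn _)) _; rewrite leq_exp2l // leq_add2l leq_mul2r.
apply/orP; right; rewrite -(leq_pmul2l kJ) big_distrr /=.
apply: (@leq_trans (\sum_(j < J) k ^ j * E)).
  by apply: leq_sum => j _; rewrite mulnC leq_divM.
rewrite -big_distrl /= leq_mul2r; apply/orP; right.
(* The powers of [k] below [k ^ J] sum to at most [k ^ J], since [k >= 2]. *)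
elim: {step kJ w E} J => [|J IH]; first by rewrite big_ord0.
rewrite big_ord_recr /= expnS; apply: leq_trans (leq_add IH (leqnn _)) _.
by rewrite addnn -mul2n leq_mul2r k1 orbT.
Qed.

End Layers.

(** * The upper bound *)

(** The falling factorial of [n + n] dominates [n ^ n] and equals a central binomial coefficient
    times the factorial; that coefficient counts some of the [4 ^ n] subsets. *)
Lemma expnn_le_fact (n : nat) : n ^ n <= 4 ^ n * n`!.
Proof.
apply: (@leq_trans ((n + n) ^_ n)).
  have : forall j, j <= n -> n ^ j <= (n + n) ^_ j.
    elim=> // j IH jn; rewrite expnSr ffactnSr leq_mul ?IH 1?ltnW //.
    by lia.
  exact.
rewrite -bin_ffact leq_mul2r; apply/orP; right.
have -> : 4 ^ n = #|[set: {set 'I_(n + n)}]|.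
  by rewrite -powersetT card_powerset cardsT card_ord addnn -mul2n expnM.
rewrite -[X in 'C(X, _)](card_ord (n + n)) -card_draws.
by apply: subset_leq_card; apply/subsetP => x; rewrite inE.
Qed.

Lemma ffact_le_exp (n j : nat) : n ^_ j <= n ^ j.
Proof. by elim: j => // j IH; rewrite expnSr ffactnSr leq_mul ?leq_subr. Qed.

Lemma bin_le_exp (n j : nat) : 'C(n, j) <= n ^ j.
Proof. by apply: leq_trans (ffact_le_exp n j); rewrite -bin_ffact leq_pmulr ?fact_gt0. Qed.

Lemma bin_mul_le (n Q : nat) : 'C(n * Q, n) <= (4 * Q) ^ n.
Proof.
rewrite -(leq_pmul2r (fact_gt0 n)) bin_ffact; apply: leq_trans (ffact_le_exp _ _) _.
by rewrite !expnMn mulnAC leq_mul2r expnn_le_fact orbT.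
Qed.

Section Upper.
Variables (k n : nat) (pi : 'S_k).

(** The graph of [s] as a set with a single layer, from which recolouring starts. *)
Definition perm_points (s : 'S_n) : {set unit * ('I_n * 'I_n)} :=
  [set (tt, (x, s x)) | x : 'I_n].

Lemma in_perm_points (s : 'S_n) p : (p \in perm_points s) = (s p.2.1 == p.2.2).
Proof.
case: p => -[] [x y]; apply/imsetP/eqP => /= [[z _ [-> ->]] // | <-].
by exists x.
Qed.

Lemma card_perm_points (s : 'S_n) : #|perm_points s| = n.
Proof. by rewrite card_imset ?card_ord // => x y []. Qed.

(** In a graph the positions of a copy determine its values; injectivity of [pi] turns the
    implications of [embeds] into the equivalences of [is_copy]. *)
Lemma card_occ_perm (s : 'S_n) : #|occ pi (perm_points s)| <= num_copies pi s.
Proof.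
pose h (cf : unit * {ffun 'I_k -> 'I_n * 'I_n}) := [ffun i => (cf.2 i).1].
have /card_in_imset <- : {in occ pi (perm_points s) &, injective h}.
  move=> [[] f] [[] g] /occP[_ fA] /occP[_ gA] /ffunP e; congr pair; apply/ffunP => i.
  have := e i; have := fA i; have := gA i; rewrite !ffunE !in_perm_points /=.
  by case: (f i) (g i) => [x y] [x' y'] /= /eqP <- /eqP <- ->.
apply: subset_leq_card; apply/subsetP => _ /imsetP[[[] f] /occP[/embedsP[f1 f2] fA] ->].
have sf i : s (f i).1 = (f i).2 by have := fA i; rewrite in_perm_points => /eqP.
rewrite inE; apply/forallP => i; apply/forallP => j; rewrite !ffunE !sf /=.
apply/andP; split; first by apply/implyP; exact: f1.
case: (ltngtP (pi i) (pi j)) => [/f2 -> //|/f2|/val_inj/perm_inj ->]; last by rewrite ltnn.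
by move=> h'; rewrite ltnNge ltnW.
Qed.

Definition good_pairs (m q : nat) : {set 'S_n * {ffun 'I_n -> 'I_q}} :=
  [set sc | (num_copies pi sc.1 <= m) &&
            (#|occ pi (recolor sc.2 (perm_points sc.1))| <= 2 * n)].

(* By Markov's inequality, at least half of the colourings of each permutation are good. *)
Lemma card_good_pairs (m q : nat) : 0 < k -> 0 < n -> 0 < q -> m <= n * q ^ k.-1 ->
  count_at_most pi n m * q ^ n <= 2 * #|good_pairs m q|.
Proof.
move=> k0 n0 q0 mq.
pose o s (chi : {ffun 'I_n -> 'I_q}) := #|occ pi (recolor chi (perm_points s))|.
pose good s := [set chi : {ffun 'I_n -> 'I_q} | o s chi <= 2 * n].
have half s : num_copies pi s <= m -> q ^ n <= 2 * #|good s|.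
  move=> sm; have qk : 0 < q * q ^ k.-1 by rewrite muln_gt0 expn_gt0 q0.
  have sum_le : \sum_chi o s chi <= n * q ^ n.
    rewrite -(leq_pmul2r qk) -expnS prednK //.
    have := sum_occ_recolor pi 'I_q (perm_points s) k0; rewrite card_ord => h.
    apply: leq_trans h _.
    apply: leq_trans (leq_mul (leq_trans (card_occ_perm s) (leq_trans sm mq)) (leqnn _)) _.
    have -> : q ^ k = q * q ^ k.-1 by rewrite -expnS prednK.
    by apply: eq_leq; clear; move: (q ^ k.-1) (q ^ n) => x y; lia.
  have : #|~: good s| * (2 * n) <= n * q ^ n.
    apply: leq_trans sum_le; rewrite -sum_nat_const big_mkcond /=.
    by apply: leq_sum => chi _; rewrite !inE -ltnNge; case: ifP => // /ltnW.
  rewrite [2 * n]mulnC mulnCA leq_pmul2l //.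
  by have := cardsC (good s); rewrite card_ffun !card_ord; lia.
have -> : #|good_pairs m q| = \sum_(s | num_copies pi s <= m) #|good s|.
  rewrite -sum1_card; under [RHS]eq_bigr do rewrite -sum1_card.
  by rewrite pair_big_dep; apply: eq_bigl => -[s chi]; rewrite !inE.
rewrite big_distrr /= /count_at_most -sum_nat_const.
rewrite (eq_bigl (fun s => num_copies pi s <= m)); last by move=> s; rewrite inE.
exact: leq_sum.
Qed.

(** A good pair is recovered from its recoloured graph. Contraction by [q] sends the graph into
    [sparse_sets], and a fibre consists of [n]-element subsets of a set of at most [n * (q * q)]
    points. *)
Lemma count_le_sparse_sets (m q J : nat) : 0 < k -> 0 < n -> 0 < q -> m <= n * q ^ k.-1 ->
  n <= q * (k ^ 2) ^ J ->
  count_at_most pi n m * q ^ n <=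
  2 * (#|sparse_sets n pi (unit * 'I_q)%type ((k ^ 2) ^ J) (2 * n)| * (4 * (q * q)) ^ n).
Proof.
move=> k0 n0 q0 mq nJ; apply: leq_trans (card_good_pairs k0 n0 q0 mq) _.
rewrite leq_mul2l /=; set N := _ ^ J in nJ *.
pose pts (sc : 'S_n * {ffun 'I_n -> 'I_q}) := recolor sc.2 (perm_points sc.1).
have ptsP sc x y c : ((tt, c, (x, y)) \in pts sc) = (sc.1 x == y) && (sc.2 x == c).
  by rewrite in_recolor in_perm_points.
have /card_in_imset <- : {in good_pairs m q &, injective pts}.
  move=> [s chi] [s' chi'] _ _ e.
  have H x : (tt, chi x, (x, s x)) \in pts (s', chi') by rewrite -e ptsP !eqxx.
  by congr pair; [apply/permP|apply/ffunP] => x; have := H x; rewrite ptsP /=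
    => /andP[/eqP e1 /eqP e2]; rewrite ?e1 ?e2.
(* The bound by [n] serves to count the fibres. *)
pose F := [set A in sparse_sets n pi (unit * 'I_q)%type N (2 * n) | #|A| <= n].
apply: (@leq_trans (#|F| * (4 * (q * q)) ^ n)); last first.
  by rewrite leq_mul2r subset_leq_card ?orbT //; apply/subsetP => A; rewrite inE => /andP[].
have szp sc : #|pts sc| = n by rewrite card_recolor card_perm_points.
apply: (card_le_fibers (f := fun A : {set (unit * 'I_q) * ('I_n * 'I_n)} => lcontract q @: A)).
  move=> _ /imsetP[sc scG ->]; rewrite inE lcontract_sparse //=.
    by rewrite -[X in _ <= X](szp sc) leq_imset_card.
  rewrite !inE; move: scG; rewrite inE => /andP[_ ->]; rewrite andbT.
  by apply/subsetP => p _; rewrite !inE !(leq_trans (ltn_ord _)).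
move=> A'; rewrite inE => /andP[_ A'n].
apply: leq_trans (bin_mul_le n (q * q)).
apply: (@leq_trans 'C(#|[set p | lcontract q p \in A']|, n)).
  rewrite -cards_draws; apply: subset_leq_card; apply/subsetP => A.
  rewrite !inE => /andP[/imsetP[sc _ ->] /eqP e]; rewrite szp eqxx andbT.
  by apply/subsetP => p pA; rewrite inE -e imset_f.
apply: leq_bin2l; apply: leq_trans (card_lcontract_preim A' q0) _.
by rewrite leq_mul2r A'n orbT.
Qed.

End Upper.

(** The least [J] satisfying the first inequality also satisfies the second, by minimality, or by
    [q <= n] if [J = 0]. *)
Lemma exp_approx (b n q : nat) : 1 < b -> 0 < q <= n ->
  exists J, n <= q * b ^ J <= b * n.
Proof.
move=> b1 /andP[q0 qn].
have ex : exists J, n <= q * b ^ J.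
  by exists n; rewrite (leq_trans (ltnW (ltn_expl n b1))) ?leq_pmull.
case: (ex_minnP ex) => J nJ minJ; exists J; rewrite nJ /=.
case: J nJ minJ => [|J] _ minJ; first by rewrite muln1 (leq_trans qn) ?leq_pmull // ltnW.
rewrite expnS mulnCA leq_mul2l; apply/orP; right; rewrite leqNgt; apply/negP => h.
by have := minJ J (ltnW h); rewrite ltnn.
Qed.

Theorem count_upper (k : nat) (pi : 'S_k) : 1 < k ->
  exists2 K, 0 < K & forall n m q, 0 < q <= n -> m <= n * q ^ (k - 1) ->
    count_at_most pi n m <= (K * q) ^ n.
Proof.
move=> k1; have k0 := ltnW k1; set b := k ^ 2; set c := mt_const k.
have b1 : 1 < b by rewrite (leq_trans k1) // /b expnS expn1 leq_pmull.
(* Exponent per point in [klazar] with [q] layers and [2 * n] copies: [q <= n] gives the 1 and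
   [q * b ^ J <= b * n] gives [c * b]. *)
pose e := 1 + (c * b + 2) * (b * b).
(* The 8 is 4 from undoing the contraction by [q] times 2 from the bad colourings, as
   [2 <= 2 ^ n]. *)
exists (8 * 2 ^ e) => [|n m q /andP[q0 qn]]; first by rewrite muln_gt0 expn_gt0.
have n0 : 0 < n by apply: leq_trans qn.
rewrite subn1 => mq; have [J /andP[nJ Jn]] : exists J, n <= q * b ^ J <= b * n.
  by apply: exp_approx; rewrite ?q0.
have qq : 0 < q ^ n by rewrite expn_gt0 q0.
rewrite -(leq_pmul2r qq); apply: leq_trans (count_le_sparse_sets pi k0 n0 q0 mq nJ) _.
have := klazar n pi (unit * 'I_q)%type J (2 * n) k1.
rewrite card_prod card_unit card_ord mul1n -/b -/c => h.
have {}h : #|sparse_sets n pi (unit * 'I_q)%type (b ^ J) (2 * n)| <= (2 ^ e) ^ n.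
  apply: leq_trans h _; rewrite -expnM leq_exp2l // [X in _ <= X]mulnDl mul1n leq_add //.
  rewrite [X in _ <= X]mulnAC leq_mul2r; apply/orP; right.
  by rewrite [X in _ <= X]mulnDl leq_add2r mulnCA -mulnA leq_mul2l Jn orbT.
have two : 2 <= 2 ^ n by rewrite -[X in X <= _]expn1 leq_exp2l.
apply: leq_trans (leq_mul two (leq_mul h (leqnn _))) _.
rewrite -!expnMn leq_exp2r //; clear.
by apply: eq_leq; move: (2 ^ e) => x; lia.
Qed.

(** * The lower bound *)

(** Composing [f] with permutations gives at most [t ^ n] functions, and each nonempty fibre is a
    coset of the stabiliser of [f]. *)
Lemma fact_le_stab (n t : nat) (f : 'I_n -> 'I_t) :
  n`! <= t ^ n * #|[set s : 'S_n | [forall x, f (s x) == f x]]|.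
Proof.
have -> : n`! = #|[set: 'S_n]| by rewrite cardsT card_Sn.
have -> : t ^ n = #|[set: {ffun 'I_n -> 'I_t}]| by rewrite cardsT card_ffun !card_ord.
apply: (card_le_fibers (f := fun s : 'S_n => [ffun x => f (s x)])) => [s _|u _].
  by rewrite inE.
have [->|[s0]] := set_0Vmem [set p in [set: 'S_n] | [ffun x => f (p x)] == u].
  by rewrite cards0.
rewrite !inE /= => /eqP/ffunP us0.
rewrite -(card_imset _ (mulgI (s0^-1)%g)); apply: subset_leq_card.
apply/subsetP => _ /imsetP[s + ->]; rewrite !inE /= => /eqP/ffunP us.
apply/forallP => x; rewrite permM; apply/eqP.
by have := us0 (s0^-1%g x); have := us (s0^-1%g x); rewrite -us0 !ffunE permKV => ->.
Qed.

Definition block_perms (n q : nat) : {set 'S_n} :=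
  [set s : 'S_n | [forall x : 'I_n, s x %/ q == x %/ q]].

Lemma card_block_perms (n q : nat) : 0 < q <= n -> q ^ n <= 8 ^ n * #|block_perms n q|.
Proof.
move=> /andP[q0 qn]; have n0 : 0 < n by apply: leq_trans qn.
(* The number of intervals, the last possibly short; [q <= n] gives [t * q <= 2 * n]. This 2 and the
   4 of [expnn_le_fact] make up the 8. *)
pose t := (n.-1 %/ q).+1.
have tq : t * q <= 2 * n.
  by have := leq_divM n.-1 q; rewrite mulSn; move: (_ * q) => z; lia.
have xt (x : 'I_n) : x %/ q < t by rewrite ltnS leq_div2r // -ltnS prednK.
have := fact_le_stab (fun x => Ordinal (xt x)).
rewrite (_ : [set s | _] = block_perms n q) => [h|]; last by apply/setP => s; rewrite !inE.
have nn : 0 < n ^ n by rewrite expn_gt0 n0.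
rewrite -(leq_pmul2l nn); apply: leq_trans (leq_mul (expnn_le_fact n) (leqnn _)) _.
apply: leq_trans (leq_mul (leq_mul (leqnn _) h) (leqnn _)) _.
have -> (S : nat) : 4 ^ n * (t ^ n * S) * q ^ n = (4 * (t * q)) ^ n * S.
  by rewrite !expnMn; clear; move: (4 ^ n) (t ^ n) (q ^ n) => x y z; lia.
rewrite [X in _ <= X]mulnA leq_mul2r -expnMn leq_exp2r //; apply/orP; right.
by rewrite mulnC; move: (t * q) tq => z; lia.
Qed.

Section Lower.
Variables (k' n : nat).
Local Notation k := k'.+1.
Variable pi : 'S_k.

Lemma is_copy_lt (s : 'S_n) x (i j : 'I_k) : is_copy pi s x -> i < j -> x i < x j.
Proof. by move/forallP/(_ i)/forallP/(_ j)/andP=> [/implyP]. Qed.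

Lemma is_copy_le (s : 'S_n) x (i j : 'I_k) : is_copy pi s x -> i <= j -> x i <= x j.
Proof.
by move=> cx; rewrite leq_eqVlt => /orP[/eqP/val_inj -> //|/(is_copy_lt cx)/ltnW].
Qed.

(** The first position of a copy fixes the interval, in which each of the other [k'] positions is
    known from its remainder modulo [q]. *)
Lemma num_copies_block (q : nat) (s : 'S_n) : 0 < q ->
  (forall x, is_copy pi s x -> x ord0 %/ q = x ord_max %/ q) ->
  num_copies pi s <= n * q ^ k'.
Proof.
case: q => // q _ H.
have same x i : is_copy pi s x -> x i %/ q.+1 = x ord0 %/ q.+1.
  move=> cx; apply/eqP; rewrite eqn_leq {1}(H x cx) !leq_div2r //.
    exact: (is_copy_le cx).
  by apply: (is_copy_le cx); rewrite -ltnS.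
pose h (x : {ffun 'I_k -> 'I_n}) :=
  (x ord0, [ffun j : 'I_k' => inord (x (lift ord0 j) %% q.+1) : 'I_q.+1]).
rewrite /num_copies -(@card_in_imset _ _ h).
  apply: leq_trans (max_card _) _.
  by rewrite card_prod card_ffun !card_ord.
move=> x y; rewrite !inE => cx cy [e0 /ffunP e1]; apply/ffunP => i.
case: (unliftP ord0 i) => [j ->|->]; last exact: e0.
have := e1 j; rewrite !ffunE => /(congr1 val); rewrite /= !inordK ?ltn_mod // => e.
apply: val_inj; rewrite /= (divn_eq (x _) q.+1) (divn_eq (y _) q.+1) e.
by rewrite (same x) // (same y) // e0.
Qed.

(* Reversing the values makes the endpoints of every copy of pi descend. *)
Definition orient : 'S_n :=
  if pi ord0 < pi ord_max then perm (@rev_ord_inj n) else 1%g.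

Lemma is_copy_orient (s : 'S_n) x : 0 < k' -> is_copy pi (s * orient)%g x ->
  x ord0 < x ord_max /\ s (x ord_max) < s (x ord0).
Proof.
move=> k0 cx; split; first exact: (is_copy_lt cx).
have ne : pi ord0 != pi ord_max.
  by rewrite (inj_eq perm_inj) -val_eqE /= eq_sym -lt0n.
have E i j := esym (eqP (proj2 (andP (forallP (forallP cx i) j)))).
have := E ord_max ord0; have := E ord0 ord_max; rewrite !permM /orient.
case: (ltnP (pi ord0) (pi ord_max)) => h.
  by rewrite !permE /= => + _; have := ltn_ord (s (x ord0)); have := ltn_ord (s (x ord_max)); lia.
have -> : pi ord_max < pi ord0 by rewrite ltn_neqAle h andbT eq_sym val_eqE.
by rewrite !perm1.
Qed.

(** From the first to the last entry of a copy in [s * orient], positions increase and values of [s]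
    decrease; as [s] preserves the intervals, both ends lie in the same one. *)
Lemma count_lower (q : nat) : 0 < k' -> 0 < q <= n ->
  q ^ n <= 8 ^ n * count_at_most pi n (n * q ^ k').
Proof.
move=> k0 /[dup] /andP[q0 _] qn; apply: leq_trans (card_block_perms qn) _.
rewrite leq_mul2l; apply/orP; right.
rewrite -(card_imset _ (mulIg orient)); apply: subset_leq_card.
apply/subsetP => _ /imsetP[s + ->]; rewrite !inE => /forallP sb.
apply: num_copies_block q0 _ => x cx; have [x01 s10] := is_copy_orient k0 cx.
apply/eqP; rewrite eqn_leq leq_div2r ?(ltnW x01) //=.
by rewrite -(eqP (sb (x ord0))) -(eqP (sb (x ord_max))) leq_div2r // ltnW.
Qed.

(** [orient] avoids [pi], since a copy in it would give a descent of the identity. *)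
Lemma count_pos (m : nat) : 0 < k' -> 0 < count_at_most pi n m.
Proof.
move=> k0; rewrite card_gt0; apply/set0Pn; exists orient; rewrite inE.
rewrite (_ : num_copies _ _ = 0) //; apply/eqP; rewrite cards_eq0; apply/eqP/setP => x.
rewrite !inE; apply/negP; rewrite -[orient]mul1g => /(is_copy_orient k0).
by rewrite !perm1 => -[] /ltnW; rewrite leqNgt => /negP.
Qed.

End Lower.

Lemma count_mono (k n m m' : nat) (pi : 'S_k) : m <= m' ->
  count_at_most pi n m <= count_at_most pi n m'.
Proof.
move=> mm; apply: subset_leq_card; apply/subsetP => s; rewrite !inE => h.
exact: leq_trans mm.
Qed.

(** * The bounds over the reals *)

Open Scope R_scope.

Lemma INR_expn (a n : nat) : INR (a ^ n)%N = pow (INR a) n.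
Proof. by elim: n => // n IH; rewrite expnS mult_INR IH. Qed.

Lemma INR_le (a b : nat) : (a <= b)%N -> INR a <= INR b.
Proof. by move=> /leP; apply: le_INR. Qed.

Lemma INR_gt0 (a : nat) : (0 < a)%N -> 0 < INR a.
Proof. by move=> /ltP; apply: lt_0_INR. Qed.

Lemma exp_ln_mul (x : R) (n : nat) : 0 < x -> exp (ln x * INR n) = pow x n.
Proof. by move=> x0; rewrite -Rpower_pow // /Rpower Rmult_comm. Qed.

Lemma Rpower_pow_root (a : R) (n d : nat) : 0 < a -> (0 < d)%N ->
  Rpower (pow a d) (INR n / INR d) = pow a n.
Proof.
move=> a0 /INR_gt0 d0; rewrite -!Rpower_pow // Rpower_mult; congr Rpower.
by field; lra.
Qed.

Lemma Rpower_le1 (y e : R) : y <= 1 -> 0 <= e -> Rpower y e <= 1.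
Proof.
move=> y1 e0; rewrite /Rpower -exp_0.
have ly : ln y <= 0.
  (* At nonpositive [y], [ln] takes the default value 0. *)
  have [y0|y0] := Rlt_dec 0 y; last by rewrite /ln; case: (Rlt_dec 0 y) => // _; lra.
  by case: y1 => [h|->]; [left; rewrite -ln_1; apply: ln_increasing | rewrite ln_1; right].
have : e * ln y <= 0 by nra.
by case=> [h|->]; [left; apply: exp_increasing | right].
Qed.

Lemma ratio_exp_ge0 (n d : nat) : (0 < d)%N -> 0 <= INR n / INR d.
Proof.
by move=> /INR_gt0 d0; apply: Rmult_le_pos; [exact: pos_INR | left; apply: Rinv_0_lt_compat].
Qed.

Lemma Rpower_ratio_ge (k n m q : nat) : (1 < k)%N -> (0 < n)%N -> (0 < q)%N ->
  (n * q ^ (k - 1) <= m)%N -> pow (INR q) n <= Rpower (INR m / INR n) (INR n / INR (k - 1)).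
Proof.
move=> k1 n0 q0 h; have d0 : (0 < k - 1)%N by rewrite subn_gt0.
rewrite -(Rpower_pow_root n (INR_gt0 q0) d0).
apply: Rle_Rpower_l; first exact: ratio_exp_ge0.
have n0' := INR_gt0 n0; split; first exact/pow_lt/INR_gt0.
apply: (Rmult_le_reg_r (INR n)) => //; rewrite /Rdiv Rmult_assoc Rinv_l; last lra.
by have := INR_le h; rewrite mult_INR INR_expn; lra.
Qed.

Lemma Rpower_ratio_le (k n m q : nat) : (1 < k)%N -> (0 < n)%N -> (0 < m)%N -> (0 < q)%N ->
  (m <= n * q ^ (k - 1))%N -> Rpower (INR m / INR n) (INR n / INR (k - 1)) <= pow (INR q) n.
Proof.
move=> k1 n0 m0 q0 h; have d0 : (0 < k - 1)%N by rewrite subn_gt0.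
rewrite -(Rpower_pow_root n (INR_gt0 q0) d0).
apply: Rle_Rpower_l; first exact: ratio_exp_ge0.
have n0' := INR_gt0 n0; split; first exact: Rdiv_lt_0_compat (INR_gt0 m0) n0'.
apply: (Rmult_le_reg_r (INR n)) => //; rewrite /Rdiv Rmult_assoc Rinv_l; last lra.
by have := INR_le h; rewrite mult_INR INR_expn; lra.
Qed.

Lemma bound_fn_ge1 (k n m : nat) : 1 <= bound_fn k n m.
Proof. exact: Rmax_l. Qed.

Lemma bound_fn_eq1 (k n m : nat) : (1 < k)%N -> (m <= n)%N -> bound_fn k n m = 1.
Proof.
move=> k1 mn; apply: Rmax_left; have d0 : (0 < k - 1)%N by rewrite subn_gt0.
(* For [n = 0] the quotient [m / n] is a default value, but the exponent is 0 and the power is 1. *)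
case: n mn => [|n] mn; first by rewrite (Rmult_0_l (/ _) : INR 0 / _ = 0) /Rpower Rmult_0_l exp_0; right.
apply: Rpower_le1; last exact: ratio_exp_ge0.
have n0 := INR_gt0 (ltn0Sn n); apply: (Rmult_le_reg_r (INR n.+1)) => //.
by rewrite /Rdiv Rmult_assoc Rinv_l; [have := INR_le mn; lra | lra].
Qed.

Lemma count_upper_real (k : nat) (pi : 'S_k) : (1 < k)%N ->
  exists C : R, forall m n : nat, (m <= 'C(n, k))%N ->
    INR (count_at_most pi n m) <= exp (C * INR n) * bound_fn k n m.
Proof.
move=> k1; have [K K0 upper] := count_upper pi k1; have d0 : (0 < k - 1)%N by rewrite subn_gt0.
(* The 2 pays for rounding the [(k - 1)]-th root of [m / n] up to an integer [q]. *)
exists (ln (INR (2 * K))) => m n mC.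
have K2 : 0 < INR (2 * K) by apply: INR_gt0; rewrite muln_gt0.
rewrite exp_ln_mul //; case: n mC => [|n'] mC.
  rewrite /= Rmult_1_l; apply: Rle_trans (bound_fn_ge1 _ _ _); apply: (INR_le (b := 1)).
  by apply: leq_trans (max_card _) _; rewrite card_Sn.
set n := n'.+1 in mC *.
have mn : (m <= n * n ^ (k - 1))%N.
  by rewrite -expnS subn1 prednK ?(ltnW k1) // (leq_trans mC) ?bin_le_exp.
have ex : exists q, (0 < q)%N && (m <= n * q ^ (k - 1))%N by exists n.
case: (ex_minnP ex) => q /andP[q0 mq] minq.
have qn : (q <= n)%N by apply: minq.
apply: (@Rle_trans _ (INR ((K * q) ^ n))); first by apply: INR_le; apply: upper; rewrite ?q0.
suff h : pow (INR q) n <= pow 2 n * bound_fn k n m.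
  rewrite INR_expn mult_INR Rpow_mult_distr mult_INR Rpow_mult_distr.
  have := pow_lt _ n (INR_gt0 K0); rewrite (_ : INR 2 = 2) //.
  by move: (pow (INR K) n) h => x h x0; rewrite [2 ^ n * x]Rmult_comm Rmult_assoc;
    apply: Rmult_le_compat_l; lra.
(* For [q = 1] the lower bound 1 on [bound_fn] suffices; otherwise [q - 1] is positive and too
   small, and [q <= 2 * (q - 1)]. *)
case: q q0 mq minq qn => // -[_ _ _ _|q _ _ minq _].
  have b1 := bound_fn_ge1 k n m; have p1 : 1 <= pow 2 n by apply: pow_R1_Rle; lra.
  by rewrite (_ : INR 1 = 1) // pow1; nra.
have qm : (n * q.+1 ^ (k - 1) <= m)%N.
  by rewrite leqNgt; apply/negP => /ltnW h; have := minq q.+1 h; rewrite ltnn.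
apply: (@Rle_trans _ (pow (2 * INR q.+1) n)).
  apply: pow_incr; split; first exact: pos_INR.
  by have := INR_le (ltn0Sn q); rewrite (S_INR q.+1) (_ : INR 1 = 1) //; lra.
rewrite Rpow_mult_distr; apply: Rmult_le_compat_l; first by apply: pow_le; lra.
apply: Rle_trans (Rmax_r _ _); exact: Rpower_ratio_ge.
Qed.

Lemma count_lower_real (k : nat) (pi : 'S_k) : (1 < k)%N ->
  exists C' : R, forall m n : nat, (m <= 'C(n, k))%N ->
    exp (C' * INR n) * bound_fn k n m <= INR (count_at_most pi n m).
Proof.
case: k pi => // k pi k1; have k0 : (0 < k)%N by [].
(* The 16 is the 8 of [count_lower] times 2 for rounding the root down to [q]. *)
exists (ln (/ 16)) => m n mC; rewrite exp_ln_mul; last lra.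
have [mn|nm] := leqP m n.
  rewrite bound_fn_eq1 // Rmult_1_r; apply: (@Rle_trans _ 1).
    by rewrite -(pow1 n); apply: pow_incr; lra.
  by have := INR_le (count_pos n pi m k0); rewrite (_ : INR 1 = 1).
have n0 : (0 < n)%N by case: n mC nm => //; rewrite bin0n /= leqn0 => /eqP ->.
have m0 : (0 < m)%N by apply: leq_ltn_trans nm.
have mlt : (m < n * n.+1 ^ (k.+1 - 1))%N.
  apply: (@leq_ltn_trans (n * n ^ k)%N); first by rewrite -expnS (leq_trans mC) ?bin_le_exp.
  by rewrite subn1 ltn_pmul2l // ltn_exp2r.
(* The wanted [q] is the predecessor of the least such [p]: [n < m] makes it positive, and the bound
   on [m] keeps it at most [n]. *)
case: (ex_minnP (ex_intro (fun p => m < n * p ^ (k.+1 - 1))%N n.+1 mlt)) => p mp minp.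
have pn := minp _ mlt.
case: p mp minp pn => [|q] mp minp qn.
  by move: mp; rewrite subn1 exp0n // muln0.
have q0 : (0 < q)%N.
  by case: q mp {minp qn} => // mp; move: mp nm; rewrite exp1n muln1 => /ltn_trans h /h; rewrite ltnn.
have qm : (n * q ^ (k.+1 - 1) <= m)%N.
  by rewrite leqNgt; apply/negP => /minp; rewrite ltnn.
have low : pow (INR q) n <= pow 8 n * INR (count_at_most pi n m).
  have qn' : (0 < q <= n)%N by rewrite q0.
  have := count_lower pi k0 qn'; rewrite subn1 in qm => h.
  have := INR_le (leq_trans h (leq_mul (leqnn _) (count_mono n pi qm))).
  by rewrite mult_INR !INR_expn (_ : INR 8 = 8) //=; lra.
have hb : bound_fn k.+1 n m <= pow (2 * INR q) n.
  have h1 := INR_le q0; rewrite /= in h1.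
  apply: Rmax_lub; first by apply: pow_R1_Rle; lra.
  apply: Rle_trans (Rpower_ratio_le k1 n0 m0 (ltn0Sn q) (ltnW mp)) _.
  by apply: pow_incr; split; [exact: pos_INR | rewrite S_INR; lra].
apply: (@Rle_trans _ (pow (/ 16) n * pow (2 * INR q) n)).
  by apply: Rmult_le_compat_l => //; apply: pow_le; lra.
have -> : pow (/ 16) n * pow (2 * INR q) n = pow (/ 8) n * pow (INR q) n.
  by rewrite -!Rpow_mult_distr; congr pow; lra.
apply: (@Rle_trans _ (pow (/ 8) n * (pow 8 n * INR (count_at_most pi n m)))).
  by apply: Rmult_le_compat_l => //; apply: pow_le; lra.
by rewrite -Rmult_assoc -Rpow_mult_distr Rinv_l ?pow1; [right; ring | lra].
Qed.

Close Scope R_scope.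
Unset Implicit Arguments.

Theorem theorem2p3 (k : nat) (hk : (1 < k)%N) (pi : 'S_k) :
  (exists C : R, forall m n : nat, (m <= 'C(n, k))%N ->
      (INR (count_at_most pi n m) <= exp (C * INR n) * bound_fn k n m)%R) /\
  (exists C' : R, forall m n : nat, (m <= 'C(n, k))%N ->
      (exp (C' * INR n) * bound_fn k n m <= INR (count_at_most pi n m))%R).
Proof. by split; [exact: count_upper_real | exact: count_lower_real]. Qed.
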